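(* Let $N$ be the number of mesh points in each direction, let $\mathcal{M}\in\{0,\mathcal{E},\mathcal{Z},\mathcal{EZ}\}$, and for $i\in\{1,\dots,N^2\}$ let $f_i(\mathbf{q})=\sum_{k,l=1}^{N^2}a^i_{k,l}(q_k-h_k)q_l$ be the $i$-th component of the vector field $J_{\mathcal{M}}$, with the coefficients $a^i_{k,l}$ given explicitly in the context. Then for every $i$ the function $f_i(\mathbf{q})$ does not depend on the variable $q_i$, i.e. $$a^i_{i,l}=a^i_{k,i}=0\qquad\text{for all } k,l=1,\dots,N^2.$$
   Context: Let $N$ be a positive integer (number of mesh points in each direction) and $\delta=2\pi/N$. Let $E$ be the $N\times N$ periodic shift matrix, $E_{r,s}=1$ if $s\equiv r+1 \pmod N$ and $0$ otherwise. Put $$D=\frac{E-E^T}{2\delta},\quad D_x=I\otimes D,\quad D_y=D\otimes I,\quad D_2=\frac{E-2I+E^T}{\delta^2},\quad \Delta_N=D_2\otimes I+I\otimes D_2,$$ with $I$ the $N\times N$ identity and $\otimes$ the Kronecker product; these are $N^2\times N^2$ matrices acting on grid functions stored as vectors of length $N^2$ by column-wise ordering. $\Delta_N$ is symmetric and singular; $\Delta_N^+$ denotes its Moore--Penrose pseudo-inverse. Set $L_x=D_x\Delta_N^+$, $L_y=D_y\Delta_N^+$. Let $\mathbf{h}\in\mathbb{R}^{N^2}$ be a fixed vector (the topography), and let $*$ denote componentwise multiplication of vectors. For $\mathbf{q}\in\mathbb{R}^{N^2}$ the Arakawa vector fields are $$J_0(\mathbf{q})=(D_x\mathbf{q})*(L_y(\mathbf{q}-\mathbf{h}))-(D_y\mathbf{q})*(L_x(\mathbf{q}-\mathbf{h})),$$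 $$J_{\mathcal{E}}(\mathbf{q})=D_x(\mathbf{q}*L_y(\mathbf{q}-\mathbf{h}))-D_y(\mathbf{q}*L_x(\mathbf{q}-\mathbf{h})),$$ $$J_{\mathcal{Z}}(\mathbf{q})=D_y((D_x\mathbf{q})*\Delta_N^+(\mathbf{q}-\mathbf{h}))-D_x((D_y\mathbf{q})*\Delta_N^+(\mathbf{q}-\mathbf{h})),$$ $$J_{\mathcal{EZ}}=\tfrac13(J_0+J_{\mathcal{E}}+J_{\mathcal{Z}}).$$ For each $\mathcal{M}\in\{0,\mathcal{E},\mathcal{Z},\mathcal{EZ}\}$, write $f_i$ for the $i$-th component of $J_{\mathcal{M}}$ and $$f_i(\mathbf{q})=\sum_{k,l=1}^{N^2}a^i_{k,l}(q_k-h_k)q_l=(\mathbf{q}-\mathbf{h})^TA^i\mathbf{q},\qquad A^i=(a^i_{k,l}),\quad i=1,\dots,N^2,$$ where the coefficients (their dependence on $\mathcal{M}$ is suppressed in the notation) are: for $\mathcal{M}=0$: $a^i_{k,l}=(D_x)_{i,l}(L_y)_{i,k}-(D_y)_{i,l}(L_x)_{i,k}$; for $\mathcal{M}=\mathcal{E}$: $a^i_{k,l}=(D_x)_{i,l}(L_y)_{l,k}-(D_y)_{i,l}(L_x)_{l,k}$; for $\mathcal{M}=\mathcal{Z}$: $a^i_{k,l}=\sum_{m=1}^{N^2}\big[(D_x)_{i,m}(D_y)_{l,m}-(D_y)_{i,m}(D_x)_{l,m}\big](\Delta_N^+)_{m,k}$; for $\mathcal{M}=\mathcal{EZ}$: $a^i_{k,l}$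 is one third of the sum of the three expressions above. *)

(* Defs.v *)
From HB Require Import structures.
From mathcomp Require Import all_boot all_order all_algebra.
From mathcomp Require Import all_classical all_reals all_analysis.
From mathcomp Require Export mxtens.

Set Implicit Arguments.
Unset Strict Implicit.
Unset Printing Implicit Defensive.

Import Order.TTheory GRing.Theory Num.Theory.
Local Open Scope ring_scope.

Section MoorePenrose.
Variables (R : realFieldType) (m n : nat).
Implicit Types (A : 'M[R]_(m, n)) (X Y : 'M[R]_(n, m)).

(* The four Penrose equations; over a real field the conjugate transpose is
   the transpose. *)
Definition is_mpinv A X : Prop :=
  [/\ A *m X *m A = A, X *m A *m X = X,
      (A *m X)^T = A *m X & (X *m A)^T = X *m A].

(* The library's [pinvmx] is only a partial inverse on the row space and is not
   the Moore-Penrose inverse.  The default value 0 is never reached, by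
   [mpinvP]. *)
Definition mpinv A : 'M[R]_(n, m) :=
  xget 0 [set X | is_mpinv A X]%classic.

Lemma is_mpinv_unique A X Y : is_mpinv A X -> is_mpinv A Y -> X = Y.
Proof.
move=> [X1 X2 X3 X4] [Y1 Y2 Y3 Y4].
have AXY : A *m X = A *m Y.
  rewrite -X3 -{1}Y1 -(mulmxA (A *m Y)) trmx_mul X3 Y3.
  by rewrite mulmxA X1.
have XAY : X *m A = Y *m A.
  rewrite -X4 -{1}Y1 -(mulmxA A) mulmxA trmx_mul X4 Y4.
  by rewrite -mulmxA (mulmxA A) X1.
by rewrite -X2 -mulmxA AXY mulmxA XAY Y2.
Qed.

End MoorePenrose.

Lemma row_free_gram_unit (R : realFieldType) (r n : nat) (B : 'M[R]_(r, n)) :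
  row_free B -> B *m B^T \in unitmx.
Proof.
move=> freeB; rewrite -row_free_unit -kermx_eq0; apply/eqP/row_matrixP => i.
rewrite row0; set u := row i _.
have uK : u *m (B *m B^T) = 0 by apply/sub_kermxP; exact: row_sub.
have v0 : u *m B = 0.
  have : (u *m B *m (u *m B)^T) 0 0 = 0.
    by rewrite trmx_mul !mulmxA -(mulmxA u) uK mul0mx mxE.
  rewrite mxE => /eqP; rewrite psumr_eq0; last first.
    by move=> j _; rewrite [_^T j 0]mxE -expr2 sqr_ge0.
  move=> /allP sq0; apply/rowP => j; rewrite [RHS]mxE.
  have /= := sq0 j (mem_index_enum _).
  by rewrite [_^T j 0]mxE mulf_eq0 orbb => /eqP.
by apply: (row_free_inj freeB); rewrite v0 mul0mx.
Qed.

Lemma is_mpinv_full_rank_fact (R : realFieldType) (m r n : nat)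
    (C : 'M[R]_(m, r)) (B : 'M[R]_(r, n)) : row_full C -> row_free B ->
  is_mpinv (C *m B)
    (B^T *m invmx (B *m B^T) *m invmx (C^T *m C) *m C^T).
Proof.
move=> fullC freeB; set GB := B *m B^T; set GC := C^T *m C.
have uB : GB \in unitmx by exact: row_free_gram_unit.
have uC : GC \in unitmx.
  rewrite /GC -{2}[C]trmxK; apply: row_free_gram_unit.
  by rewrite /row_free mxrank_tr.
have tGB : (invmx GB)^T = invmx GB by rewrite trmx_inv trmx_mul trmxK.
have tGC : (invmx GC)^T = invmx GC by rewrite trmx_inv trmx_mul trmxK.
set X := _ *m C^T.
have AX : C *m B *m X = C *m invmx GC *m C^T.
  by rewrite /X !mulmxA -(mulmxA C B) -/GB -(mulmxA C GB) mulmxV // mulmx1.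
have XA : X *m (C *m B) = B^T *m invmx GB *m B.
  by rewrite /X !mulmxA -(mulmxA _ C^T C) -/GC -(mulmxA _ (invmx GC))
             mulVmx // mulmx1.
split.
- by rewrite AX !mulmxA -(mulmxA _ C^T C) -/GC -(mulmxA _ _ GC)
             mulVmx // mulmx1.
- by rewrite XA /X !mulmxA -(mulmxA _ B B^T) -/GB -(mulmxA _ _ GB)
             mulVmx // mulmx1.
- by rewrite AX !trmx_mul trmxK tGC mulmxA.
- by rewrite XA !trmx_mul trmxK tGB mulmxA.
Qed.

Lemma mpinvP (R : realFieldType) (m n : nat) (A : 'M[R]_(m, n)) :
  is_mpinv A (mpinv A).
Proof.
apply: (@xgetPex _ 0 [set X | is_mpinv A X]%classic).
have := is_mpinv_full_rank_fact (col_base_full A) (row_base_free A).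
by rewrite mulmx_base => AP; eexists; exact: AP.
Qed.

Inductive scheme := Sch0 | SchE | SchZ | SchEZ.

Section Arakawa.
Variables (R : realType) (N : nat).

Definition mesh : R := 2 * pi / N%:R.

Definition shiftmx : 'M[R]_N := \matrix_(r, s) (s == r.+1 %[mod N])%:R.

Definition Dmx : 'M[R]_N := (2 * mesh)^-1 *: (shiftmx - shiftmx^T).

Definition D2mx : 'M[R]_N :=
  (mesh ^+ 2)^-1 *: (shiftmx - 2%:M + shiftmx^T).

(* Under [*t], the pair (r, s) of 0-based indices has index r * N + s, so the
   right factor acts within each column of a grid function stored column by
   column. *)
Definition Dx : 'M[R]_(N * N) := 1%:M *t Dmx.
Definition Dy : 'M[R]_(N * N) := Dmx *t 1%:M.
Definition Lap : 'M[R]_(N * N) := D2mx *t 1%:M + 1%:M *t D2mx.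
Definition LapP : 'M[R]_(N * N) := mpinv Lap.
Definition Lx : 'M[R]_(N * N) := Dx *m LapP.
Definition Ly : 'M[R]_(N * N) := Dy *m LapP.

Definition cmul (u v : 'cV[R]_(N * N)) : 'cV[R]_(N * N) := map2_mx *%R u v.
Local Notation "u .* v" := (cmul u v) (at level 40, left associativity).

Implicit Types h q : 'cV[R]_(N * N).

Definition J0 h q := (Dx *m q) .* (Ly *m (q - h)) - (Dy *m q) .* (Lx *m (q - h)).

Definition JE h q :=
  Dx *m (q .* (Ly *m (q - h))) - Dy *m (q .* (Lx *m (q - h))).

Definition JZ h q :=
  Dy *m ((Dx *m q) .* (LapP *m (q - h)))
  - Dx *m ((Dy *m q) .* (LapP *m (q - h))).

Definition J (M : scheme) h q : 'cV[R]_(N * N) :=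
  match M with
  | Sch0 => J0 h q
  | SchE => JE h q
  | SchZ => JZ h q
  | SchEZ => 3^-1 *: (J0 h q + JE h q + JZ h q)
  end.

Implicit Types i k l : 'I_(N * N).

Definition acoef0 i k l : R := Dx i l * Ly i k - Dy i l * Lx i k.

Definition acoefE i k l : R := Dx i l * Ly l k - Dy i l * Lx l k.

Definition acoefZ i k l : R :=
  \sum_m (Dx i m * Dy l m - Dy i m * Dx l m) * LapP m k.

(* [acoef M i k l] is the entry a^i_{k,l} of the matrix A^i: k indexes q - h and
   l indexes q. *)
Definition acoef (M : scheme) i k l : R :=
  match M with
  | Sch0 => acoef0 i k l
  | SchE => acoefE i k l
  | SchZ => acoefZ i k l
  | SchEZ => 3^-1 * (acoef0 i k l + acoefE i k l + acoefZ i k l)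
  end.

End Arakawa.

(* Main.v *)
(** The discrete Laplacian is invariant under the reflections of the periodic
    grid in the two coordinate lines through a grid point [i] and, since the
    mesh is the same in both directions, under the reflection in the diagonal
    through [i].  Uniqueness of the Moore-Penrose inverse transfers these
    symmetries to the pseudo-inverse [G].  As the centred differences are odd,
    [Ly] vanishes between points of the same y-coordinate and [Lx] between points
    of the same x-coordinate, which settles the schemes 0 and E.  For Z,
    the four nearest neighbours of [i] are exchanged by the symmetries fixing
    [i], so [G] takes the same value there and the two products of differences
    cancel.  The vanishing of a^i_{k,i} only needs the zero diagonals of the
    difference matrices. *)

Require Import Defs.
From HB Require Import structures.
From mathcomp Require Import all_boot all_order all_algebra.
From mathcomp Require Import all_classical all_reals all_analysis.
From mathcomp Require Import ring.

Set Implicit Arguments.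
Unset Strict Implicit.

Import Order.TTheory GRing.Theory Num.Theory.
Local Open Scope ring_scope.

(** * Pseudo-inverses under simultaneous row and column permutations *)

Lemma mxsub_mulmx_bij (R : pzRingType) (n : nat) (f : 'I_n -> 'I_n)
    (A B : 'M[R]_n) : bijective f ->
  mxsub f f (A *m B) = mxsub f f A *m mxsub f f B.
Proof.
move=> bf; apply/matrixP => i j; rewrite !mxE (reindex f) /=; last exact: onW_bij.
by apply: eq_bigr => k _; rewrite !mxE.
Qed.

(** The permuted pseudo-inverse satisfies the four Penrose equations for the permuted matrix, which
    is [A] again. *)
Lemma mpinv_mxsub_bij (R : realFieldType) (n : nat) (f : 'I_n -> 'I_n)
    (A : 'M[R]_n) : bijective f -> mxsub f f A = A ->
  mxsub f f (mpinv A) = mpinv A.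
Proof.
move=> bf fA; have := mpinvP A; move: (mpinv A) => X AX; have [X1 X2 X3 X4] := AX.
have key (B C : 'M[R]_n) := mxsub_mulmx_bij B C bf.
apply: is_mpinv_unique AX; split.
- by rewrite -{1 2}fA -!key X1 fA.
- by rewrite -{1}fA -!key X2.
- by rewrite -{1 2}fA -!key trmx_mxsub X3.
- by rewrite -{1 2}fA -!key trmx_mxsub X4.
Qed.

(** * One-dimensional periodic difference matrices *)

Section PeriodicDifferences.
Variables (R : realType) (n : nat).
Implicit Types r s t : 'I_n.+1.

(** The congruence becomes an equation in the cyclic group on ['I_n.+1], so reflections and
    translations are handled by group algebra. *)
Lemma shiftmxE r s : shiftmx R n.+1 r s = (s == r + inZp 1)%:R.
Proof.
rewrite mxE; congr (nat_of_bool _)%:R.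
by rewrite -(inj_eq val_inj) /= modnDmr addn1 (modn_small (ltn_ord s)).
Qed.

Lemma DmxE r s :
  Dmx R n.+1 r s =
    (2 * mesh R n.+1)^-1 * ((s == r + inZp 1)%:R - (r == s + inZp 1)%:R).
Proof. by rewrite !mxE -!shiftmxE !mxE. Qed.

Lemma D2mxE r s :
  D2mx R n.+1 r s = (mesh R n.+1 ^+ 2)^-1 *
    ((s == r + inZp 1)%:R - 2 *+ (r == s) + (r == s + inZp 1)%:R).
Proof. by rewrite !mxE -!shiftmxE !mxE. Qed.

Lemma Dmx_tr r s : Dmx R n.+1 s r = - Dmx R n.+1 r s.
Proof. by rewrite !DmxE -mulrN opprB. Qed.

Lemma Dmx_diag r : Dmx R n.+1 r r = 0.
Proof. by rewrite DmxE subrr mulr0. Qed.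

(** A reflection turns the shift into its transpose; this makes [Dmx] odd and [D2mx] even. *)
Lemma refl_shift_eq t r s :
  (t - s == t - r + inZp 1) = (r == s + inZp 1).
Proof.
by rewrite -addrA (inj_eq (addrI t)) eqr_oppLR opprD opprK -subr_eq opprK eq_sym.
Qed.

Lemma Dmx_refl t r s : Dmx R n.+1 (t - r) (t - s) = - Dmx R n.+1 r s.
Proof. by rewrite !DmxE !refl_shift_eq -mulrN opprB. Qed.

Lemma D2mx_refl t r s : D2mx R n.+1 (t - r) (t - s) = D2mx R n.+1 r s.
Proof.
rewrite !D2mxE !refl_shift_eq (inj_eq (addrI t)) (inj_eq oppr_inj).
by congr (_ * _); rewrite addrAC [RHS]addrAC [_%:R + _%:R]addrC.
Qed.

Lemma D2mx_transl t r s : D2mx R n.+1 (r + t) (s + t) = D2mx R n.+1 r s.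
Proof. by rewrite !D2mxE ![_ + t + _]addrAC !(inj_eq (addIr t)). Qed.

Lemma Dmx_neq0 r s : Dmx R n.+1 r s != 0 -> s = r + inZp 1 \/ s = r - inZp 1.
Proof.
rewrite DmxE; case: (s =P _) => [->|_]; first by left.
case: (r =P _) => [->|_]; first by right; rewrite addrK.
by rewrite subrr mulr0 eqxx.
Qed.

End PeriodicDifferences.

(** * Grid symmetries of the pseudo-inverse *)

Section Grid.
Variables (R : realType) (n : nat).
Local Notation N := n.+1.
Local Notation ix := (@mxtens_index N N).
Local Notation D := (Dmx R N).
Local Notation G := (LapP R N).
Implicit Types (a b c d : 'I_N) (i k l : 'I_(N * N)).

Lemma DxE a b c d : Dx R N (ix (a, b)) (ix (c, d)) = (a == c)%:R * D b d.
Proof. by rewrite /Dx tensmxE [1%:M _ _]mxE. Qed.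

Lemma DyE a b c d : Dy R N (ix (a, b)) (ix (c, d)) = D a c * (b == d)%:R.
Proof. by rewrite /Dy tensmxE [1%:M _ _]mxE. Qed.

Lemma LapE a b c d :
  Lap R N (ix (a, b)) (ix (c, d)) =
    D2mx R N a c * (b == d)%:R + (a == c)%:R * D2mx R N b d.
Proof. by rewrite /Lap mxE !tensmxE ![1%:M _ _]mxE. Qed.

Lemma sum_grid (F : 'I_(N * N) -> R) :
  \sum_i F i = \sum_a \sum_b F (ix (a, b)).
Proof.
rewrite pair_bigA /= (reindex ix) /=.
  by apply: eq_bigr => -[a b].
by exists (@mxtens_unindex N N) => x _;
  [exact: mxtens_indexK | exact: mxtens_unindexK].
Qed.

Lemma LapP_sym (f : 'I_N * 'I_N -> 'I_N * 'I_N) : involutive f ->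
  (forall x y, Lap R N (ix (f x)) (ix (f y)) = Lap R N (ix x) (ix y)) ->
  forall x y, G (ix (f x)) (ix (f y)) = G (ix x) (ix y).
Proof.
move=> fK fL x y; pose g i := ix (f (mxtens_unindex i)).
have gK : involutive g.
  by move=> i; rewrite /g mxtens_indexK fK mxtens_unindexK.
have gL : mxsub g g (Lap R N) = Lap R N.
  by apply/matrixP => i j; rewrite mxE /g fL !mxtens_unindexK.
have /matrixP/(_ (ix x) (ix y)) := mpinv_mxsub_bij (inv_bij gK) gL.
by rewrite mxE /g !mxtens_indexK.
Qed.

(** The first index of a pair is the y-coordinate. The choice [t = a + a] gives the reflection
    fixing [a]. *)
Lemma LapP_refly t a b c d :
  G (ix (t - a, b)) (ix (t - c, d)) = G (ix (a, b)) (ix (c, d)).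
Proof.
apply: (@LapP_sym (fun x => (t - x.1, x.2)) _ _ (a, b) (c, d)) => [[x y]|[x y] [z w]] /=.
  by rewrite subKr.
by rewrite !LapE D2mx_refl (inj_eq (addrI t)) (inj_eq oppr_inj).
Qed.

Lemma LapP_reflx t a b c d :
  G (ix (a, t - b)) (ix (c, t - d)) = G (ix (a, b)) (ix (c, d)).
Proof.
apply: (@LapP_sym (fun x => (x.1, t - x.2)) _ _ (a, b) (c, d)) => [[x y]|[x y] [z w]] /=.
  by rewrite subKr.
by rewrite !LapE D2mx_refl (inj_eq (addrI t)) (inj_eq oppr_inj).
Qed.

(** Swapping coordinates exchanges the two Kronecker terms of [Lap], and [D2mx] is translation
    invariant. For [t = a - b] the map fixes [(a, b)]. *)
Lemma LapP_diag t a b c d :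
  G (ix (b + t, a - t)) (ix (d + t, c - t)) = G (ix (a, b)) (ix (c, d)).
Proof.
apply: (@LapP_sym (fun x => (x.2 + t, x.1 - t)) _ _ (a, b) (c, d)) => [[x y]|[x y] [z w]] /=.
  by rewrite subrK addrK.
rewrite !LapE !D2mx_transl !(inj_eq (addIr _)).
by rewrite addrC mulrC [_%:R * _]mulrC [X in X + _]mulrC.
Qed.

Lemma LapP_neighbours a b c d : D a c != 0 -> D b d != 0 ->
  G (ix (a, d)) (ix (a, b)) = G (ix (c, b)) (ix (a, b)).
Proof.
move=> /Dmx_neq0 ac /Dmx_neq0 bd.
(* The diagonal reflection through [(a, b)] sends [(c, b)] to [(a, b + (c - a))]. This is [(a, d)]
   or its mirror image in [b], and [refl] covers the latter case. *)
rewrite -[RHS](LapP_diag (a - b)) [b + _]addrC subrK [a - (a - b)]subKr opprB.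
have refl x : G (ix (a, b - x)) (ix (a, b)) = G (ix (a, b + x)) (ix (a, b)).
  by rewrite -[RHS](LapP_reflx (b + b)) opprD addrA !addrK.
have -> : c + (b - a) = b + (c - a) by rewrite addrCA.
by case: ac => ->; case: bd => ->; rewrite addrAC subrr add0r // refl.
Qed.

Lemma LyE a b l :
  Ly R N (ix (a, b)) l = \sum_c D a c * G (ix (c, b)) l.
Proof.
rewrite /Ly mxE sum_grid; apply: eq_bigr => c _.
rewrite (bigD1 b) //= big1 ?addr0 => [|d]; first by rewrite DyE eqxx mulr1.
by rewrite eq_sym DyE => /negPf->; rewrite mulr0 mul0r.
Qed.

Lemma LxE a b l :
  Lx R N (ix (a, b)) l = \sum_d D b d * G (ix (a, d)) l.
Proof.
rewrite /Lx mxE sum_grid exchange_big; apply: eq_bigr => d _ /=.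
rewrite (bigD1 a) //= big1 ?addr0 => [|c]; first by rewrite DxE eqxx mul1r.
by rewrite eq_sym DxE => /negPf->; rewrite !mul0r.
Qed.

Lemma eq_opp0 (x : R) : x = - x -> x = 0.
Proof. by move/eqP; rewrite -subr_eq0 opprK -mulr2n mulrn_eq0 => /eqP. Qed.

Lemma subr_bij (t : 'I_N) : bijective (fun x => t - x).
Proof. by apply: inv_bij => x; rewrite subKr. Qed.

(** Reflecting the summation index about [a] flips the sign of [D] and preserves [G], so the sum
    equals its own opposite. *)
Lemma Ly_same_y a b d : Ly R N (ix (a, d)) (ix (a, b)) = 0.
Proof.
apply: eq_opp0; rewrite {1}LyE (reindex (fun x => a + a - x)) /=; last first.
  exact/onW_bij/subr_bij.
rewrite LyE -sumrN; apply: eq_bigr => c _.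
(* The selected occurrences are the row index of [D] and the y-coordinate of the second point of
   [G], rewritten as their own reflections. *)
have {1 6}-> : a = a + a - a by rewrite addrK.
by rewrite Dmx_refl LapP_refly mulNr.
Qed.

Lemma Lx_same_x a b c : Lx R N (ix (c, b)) (ix (a, b)) = 0.
Proof.
apply: eq_opp0; rewrite {1}LxE (reindex (fun x => b + b - x)) /=; last first.
  exact/onW_bij/subr_bij.
rewrite LxE -sumrN; apply: eq_bigr => d _.
have {1 6}-> : b = b + b - b by rewrite addrK.
by rewrite Dmx_refl LapP_reflx mulNr.
Qed.

Lemma Dx_diag i : Dx R N i i = 0.
Proof.
by rewrite -(mxtens_unindexK i); case: mxtens_unindex => a b; rewrite DxE Dmx_diag mulr0.
Qed.

Lemma Dy_diag i : Dy R N i i = 0.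
Proof.
by rewrite -(mxtens_unindexK i); case: mxtens_unindex => a b; rewrite DyE Dmx_diag mul0r.
Qed.

Lemma Dx_tr i l : Dx R N l i = - Dx R N i l.
Proof.
rewrite -(mxtens_unindexK i) -(mxtens_unindexK l).
case: (mxtens_unindex i) (mxtens_unindex l) => [a b] [c d].
by rewrite !DxE Dmx_tr mulrN eq_sym.
Qed.

Lemma Dy_tr i l : Dy R N l i = - Dy R N i l.
Proof.
rewrite -(mxtens_unindexK i) -(mxtens_unindexK l).
case: (mxtens_unindex i) (mxtens_unindex l) => [a b] [c d].
by rewrite !DyE Dmx_tr mulNr eq_sym.
Qed.

(** * Vanishing of the coefficients *)

Lemma acoef0_col i k : acoef0 R i k i = 0.
Proof. by rewrite /acoef0 Dx_diag Dy_diag !mul0r subrr. Qed.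

Lemma acoefE_col i k : acoefE R i k i = 0.
Proof. by rewrite /acoefE Dx_diag Dy_diag !mul0r subrr. Qed.

(** For [l = i] the two products in each summand differ only in the order of their factors. *)
Lemma acoefZ_col i k : acoefZ R i k i = 0.
Proof. by apply: big1 => m _; rewrite [X in X - _]mulrC subrr mul0r. Qed.

Lemma acoef0_row i l : acoef0 R i i l = 0.
Proof.
rewrite /acoef0 -(mxtens_unindexK i); case: mxtens_unindex => a b.
by rewrite Ly_same_y Lx_same_x !mulr0 subrr.
Qed.

(** A nonzero [Dx i l] forces [i] and [l] to share their y-coordinate, where [Ly l i] vanishes;
    symmetrically for [Dy] and [Lx]. *)
Lemma acoefE_row i l : acoefE R i i l = 0.
Proof.
rewrite /acoefE -(mxtens_unindexK i) -(mxtens_unindexK l).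
case: (mxtens_unindex i) (mxtens_unindex l) => [a b] [c d]; rewrite DxE DyE.
case: eqP => [<-|_]; case: eqP => [<-|_];
  by rewrite ?Ly_same_y ?Lx_same_x ?(mulr0, mul0r) subrr.
Qed.

Lemma acoefZ_row i l : acoefZ R i i l = 0.
Proof.
rewrite /acoefZ -(mxtens_unindexK i) -(mxtens_unindexK l).
case: (mxtens_unindex i) (mxtens_unindex l) => [a b] [c d].
under eq_bigr do rewrite mulrBl; rewrite sumrB !sum_grid.
(* The first sum collapses to the single grid point [m = (a, d)]. *)
rewrite (bigD1 a) //= [X in _ + X - _]big1 => [|r]; last first.
  by rewrite eq_sym => /negPf ar; rewrite big1 // => s _; rewrite DxE ar !mul0r.
rewrite (bigD1 d) //= big1 => [|s]; last first.
  by rewrite eq_sym => /negPf ds; rewrite DyE ds mulr0 mulr0 mul0r.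
(* The second sum collapses to [m = (c, b)]. *)
rewrite exchange_big (bigD1 b) //= [X in _ - (_ + X)]big1 => [|s]; last first.
  by rewrite eq_sym => /negPf bs; rewrite big1 // => r _; rewrite DyE bs mulr0 !mul0r.
rewrite [X in _ - (X + _)](bigD1 c) //= [X in _ - (_ + X + _)]big1 => [|r]; last first.
  by rewrite eq_sym => /negPf cr; rewrite DxE cr mul0r mulr0 mul0r.
rewrite !DxE !DyE !eqxx !addr0 !mul1r !mulr1 (Dmx_tr _ a c) (Dmx_tr _ b d).
(* Up to sign both terms carry the factor [D a c * D b d], so the values of [G] need comparing only
   when it is nonzero. *)
have [->|ac] := eqVneq (D a c) 0; first by rewrite oppr0 mulr0 !mul0r subrr.
have [->|bd] := eqVneq (D b d) 0; first by rewrite oppr0 mulr0 !mul0r subrr.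
by rewrite (LapP_neighbours ac bd) !mulrN [D a c * _]mulrC subrr.
Qed.

Lemma acoef_row M i l : acoef R M i i l = 0.
Proof.
by case: M; rewrite /= ?acoef0_row ?acoefE_row ?acoefZ_row // !addr0 mulr0.
Qed.

Lemma acoef_col M i k : acoef R M i k i = 0.
Proof.
by case: M; rewrite /= ?acoef0_col ?acoefE_col ?acoefZ_col // !addr0 mulr0.
Qed.

(** * Bilinear expansion of the vector fields *)

Implicit Types (A B C : 'M[R]_(N * N)) (h q u v : 'cV[R]_(N * N)).

Lemma cmul_mulmx2 A B u v i :
  cmul (A *m u) (B *m v) i 0 = \sum_k \sum_l A i l * B i k * v k 0 * u l 0.
Proof.
rewrite !mxE mulrC mulr_suml; apply: eq_bigr => k _.
by rewrite mulr_sumr; apply: eq_bigr => l _; ring.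
Qed.

Lemma mulmx_cmul A B u v i :
  (A *m cmul u (B *m v)) i 0 = \sum_k \sum_l A i l * B l k * v k 0 * u l 0.
Proof.
rewrite mxE exchange_big; apply: eq_bigr => l _.
by rewrite !mxE mulrCA mulrA mulr_sumr; apply: eq_bigr => k _; ring.
Qed.

Lemma mulmx_cmul2 A B C u v i :
  (A *m cmul (B *m u) (C *m v)) i 0 =
    \sum_k \sum_l (\sum_m A i m * B m l * C m k) * v k 0 * u l 0.
Proof.
rewrite mxE; under eq_bigr do rewrite cmul_mulmx2 mulr_sumr.
rewrite exchange_big; apply: eq_bigr => k _ /=.
under eq_bigr do rewrite mulr_sumr; rewrite exchange_big.
apply: eq_bigr => l _; rewrite !mulr_suml; apply: eq_bigr => m _; ring.
Qed.

Lemma J0_entry h q i :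
  J0 h q i 0 = \sum_k \sum_l acoef0 R i k l * (q k 0 - h k 0) * q l 0.
Proof.
rewrite /J0 mxE [X in _ + X]mxE !cmul_mulmx2 -sumrB.
apply: eq_bigr => k _; rewrite -sumrB; apply: eq_bigr => l _.
by rewrite [(q - h) _ _]mxE [(- h) _ _]mxE -!mulrBl.
Qed.

Lemma JE_entry h q i :
  JE h q i 0 = \sum_k \sum_l acoefE R i k l * (q k 0 - h k 0) * q l 0.
Proof.
rewrite /JE mxE [X in _ + X]mxE !mulmx_cmul -sumrB.
apply: eq_bigr => k _; rewrite -sumrB; apply: eq_bigr => l _.
by rewrite [(q - h) _ _]mxE [(- h) _ _]mxE -!mulrBl.
Qed.

Lemma JZ_entry h q i :
  JZ h q i 0 = \sum_k \sum_l acoefZ R i k l * (q k 0 - h k 0) * q l 0.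
Proof.
rewrite /JZ mxE [X in _ + X]mxE !mulmx_cmul2 -sumrB.
apply: eq_bigr => k _; rewrite -sumrB; apply: eq_bigr => l _.
rewrite [(q - h) _ _]mxE [(- h) _ _]mxE -!mulrBl -sumrB.
congr (_ * _ * _); apply: eq_bigr => m _.
(* The expansion produces [Dx m l] and [Dy m l], the coefficients [Dx l m] and [Dy l m]; the signs
   from skew-symmetry match the opposite order of the two products. *)
by rewrite (Dx_tr l) (Dy_tr l); ring.
Qed.

Lemma J_entry M h q i :
  J M h q i 0 = \sum_k \sum_l acoef R M i k l * (q k 0 - h k 0) * q l 0.
Proof.
case: M => /=; [exact: J0_entry|exact: JE_entry|exact: JZ_entry|].
rewrite mxE [X in _ * X]mxE [X in _ * (X + _)]mxE J0_entry JE_entry JZ_entry.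
rewrite -!big_split mulr_sumr; apply: eq_bigr => k _ /=.
rewrite -!big_split mulr_sumr; apply: eq_bigr => l _ /=.
by rewrite -!mulrDl !mulrA.
Qed.

End Grid.

Unset Implicit Arguments.

Theorem proposition2 (R : realType) (N : nat) (hN : (0 < N)%N) (M : scheme)
    (h : 'cV[R]_(N * N)) (i : 'I_(N * N)) :
  [/\ (* f_i is the i-th component of J_M *)
      forall q : 'cV[R]_(N * N),
        J M h q i 0 = \sum_k \sum_l acoef R M i k l * (q k 0 - h k 0) * q l 0,
      (* f_i does not depend on q_i *)
      forall q q' : 'cV[R]_(N * N),
        (forall k, k != i -> q k 0 = q' k 0) -> J M h q i 0 = J M h q' i 0
    & forall k l : 'I_(N * N), acoef R M i i l = 0 /\ acoef R M i k i = 0].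
Proof.
case: N hN h i => // n _ h i; split=> [q|q q' qq'|k l].
- exact: J_entry.
- rewrite !J_entry; apply: eq_bigr => k _; apply: eq_bigr => l _.
  (* Terms with [k = i] or [l = i] have zero coefficient; the others only see entries where [q] and
     [q'] agree. *)
  have [->|ki] := eqVneq k i; first by rewrite acoef_row !mul0r.
  have [->|li] := eqVneq l i; first by rewrite acoef_col !mul0r.
  by rewrite !qq'.
- by rewrite acoef_row acoef_col.
Qed.
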